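(* Let \[ F_{k,1}(q)=\sum_{n\ge 0}\frac{\left(q^{2n+2};q^2\right)_\infty\left(q^{2n+2k};q^2\right)_\infty}{\left(q^{2n+1};q^2\right)_\infty^2}\,q^{2n+1}\qquad(k\in\mathbb{N}) \] and let $\omega(q):=\sum_{n\ge0}\frac{q^{2n(n+1)}}{\left(q;q^2\right)_{n+1}^2}$ be Ramanujan's third order mock theta function. Then \[ \lim_{k\to\infty}F_{k,1}(q)=q\,\omega(q). \]
   Context: For $n\in\mathbb{N}_0\cup\{\infty\}$, $(a;q)_n:=\prod_{j=0}^{n-1}(1-aq^j)$. All series are considered for $|q|<1$ (equivalently, as formal power series, with the limit taken coefficientwise). *)

(* Defs.v *)
From mathcomp Require Export all_boot all_order all_algebra.
From mathcomp Require Export complex.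
From mathcomp Require Export boolp classical_sets reals topology normedtype.
From mathcomp Require Export sequences.
Export numFieldNormedType.Exports.

Set Implicit Arguments.
Unset Strict Implicit.
Unset Printing Implicit Defensive.

Import Order.TTheory GRing.Theory Num.Theory.

Local Open Scope classical_set_scope.
Local Open Scope ring_scope.
Local Open Scope complex_scope.

(* The complex numbers R[i] carry their usual (norm) topology only through the
   regular-module alias R[i]^o, to which they are convertible. *)

Definition qpoch (R : realType) (a q : R[i]^o) (n : nat) : R[i]^o :=
  \prod_(j < n) (1 - a * q ^+ j).

Definition qpoch_inf (R : realType) (a q : R[i]^o) : R[i]^o :=
  limn (qpoch a q).

(* limn is total; for |q| < 1 every limit below exists and no denominator
   vanishes. *)
Definition F1_term (R : realType) (k : nat) (q : R[i]^o) (n : nat) : R[i]^o :=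
  qpoch_inf (q ^+ (2 * n + 2)) (q ^+ 2)
    * qpoch_inf (q ^+ (2 * n + 2 * k)) (q ^+ 2)
    / qpoch_inf (q ^+ (2 * n + 1)) (q ^+ 2) ^+ 2
    * q ^+ (2 * n + 1).

Definition F1 (R : realType) (k : nat) (q : R[i]^o) : R[i]^o :=
  limn (series (F1_term k q)).

Definition omega_term (R : realType) (q : R[i]^o) (n : nat) : R[i]^o :=
  q ^+ (2 * n * (n + 1)) / qpoch q (q ^+ 2) n.+1 ^+ 2.

Definition omega (R : realType) (q : R[i]^o) : R[i]^o :=
  limn (series (omega_term q)).

(* Main.v *)
Require Import Defs.
From mathcomp Require Import exp ring lra zify.
Import Order.TTheory GRing.Theory Num.Theory.
Import ComplexField.Normc.
Local Open Scope classical_set_scope.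
Local Open Scope ring_scope.
Local Open Scope complex_scope.

Set Implicit Arguments.
Unset Strict Implicit.
Unset Printing Implicit Defensive.

(** Put [p = q^2] and
    [U(a) = sum_n (p^(n+1); p)_oo p^n / (a p^n; p)_oo^2], a [2phi1] series.
    As [(p^(n+k); p)_oo -> 1] at a geometric rate uniform in [n], the limit of
    [F_(k,1)(q)] is [q U(q)].  The sequence
    [c_n = (p^n; p)_oo (1 - a^2 p^n) / (a p^n; p)_oo^2] satisfies
    [c_(n+1) - c_n = (1 - a)^2 u_n(a) - a^2 p u_n(a p)], where [u_n] is the
    summand of [U], and it goes from [c_0 = 0] to [1]; summing up,
    [(1 - a)^2 U(a) = 1 + a^2 p U(a p)].  Iterating this from [a = q] produces
    the partial sums of [omega(q)], with a remainder tending to [0]. *)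

(** * Real-valued modulus and limits of complex sequences *)

Lemma norm_normc (R : realType) (z : R[i]^o) : `|z| = (normc z)%:C.
Proof. by case: z. Qed.

Lemma normc_ge0 (R : realType) (z : R[i]^o) : 0 <= normc z.
Proof. by case: z => a b; exact: sqrtr_ge0. Qed.

Lemma normcX (R : realType) (z : R[i]^o) n : normc (z ^+ n) = normc z ^+ n.
Proof. by elim: n => [|n IH]; rewrite ?expr0 ?normc1// !exprS normcM IH. Qed.

Lemma normcB_le (R : realType) (x y : R[i]^o) :
  normc (x - y) <= normc x + normc y.
Proof. by rewrite -[normc y]normcN; exact: le_normcD. Qed.

Lemma normcBC (R : realType) (x y : R[i]^o) : normc (x - y) = normc (y - x).
Proof. by rewrite -opprB normcN. Qed.

Lemma normcB_ge (R : realType) (x y : R[i]^o) :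
  normc x - normc y <= normc (x - y).
Proof. by have := le_normcD (x - y) y; rewrite subrK; lra. Qed.

(** The norm of [R[i]] takes its values in [R[i]], so the radii in its topology are positive
    elements of [R[i]]. Such elements are real, hence complex and real radii can be exchanged. All
    later estimates then take place in the ordered field [R]. *)
Lemma cvg_normcP (R : realType) (u : nat -> R[i]^o) (l : R[i]^o) :
  u @ \oo --> l <-> normc (l - u n) @[n --> \oo] --> 0.
Proof.
split=> [/cvgrPdist_lt ul|/cvgrPdist_lt ul]; apply/cvgrPdist_lt => e e0.
- have e0' : 0 < e%:C by rewrite ltcR.
  apply: filterS (ul _ e0') => n; rewrite norm_normc ltcR sub0r normrN.
  by rewrite ger0_norm// normc_ge0.
- have eE : e = (complex.Re e)%:C by rewrite RRe_real// ger0_real// ltW.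
  have e0' : 0 < complex.Re e by rewrite -ltcR -eE.
  apply: filterS (ul _ e0') => n; rewrite sub0r normrN ger0_norm ?normc_ge0//.
  by rewrite norm_normc -ltcR -eE.
Qed.

Lemma cvg_normc_le (R : realType) (u : nat -> R[i]^o) (l : R[i]^o)
    (d : nat -> R) :
  (forall n, normc (l - u n) <= d n) -> d @ \oo --> 0 -> u @ \oo --> l.
Proof.
move=> ud d0; apply/cvg_normcP; apply: squeeze_cvgr d0; last exact: cvg_cst.
by apply: nearW => n; rewrite normc_ge0 ud.
Qed.

Lemma cvg_normc (R : realType) (u : nat -> R[i]^o) (l : R[i]^o) :
  u @ \oo --> l -> normc (u n) @[n --> \oo] --> normc l.
Proof.
move=> /cvg_normcP ul; apply/cvgrPdist_le => e e0.
move/cvgrPdist_le : ul => /(_ _ e0); apply: filterS => n.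
rewrite sub0r normrN ger0_norm ?normc_ge0// => /(le_trans _); apply.
rewrite ler_norml normcB_ge andbT lerNl opprB (le_trans (normcB_ge _ _))//.
by rewrite normcBC.
Qed.

Lemma limc_unique (R : realType) (u : nat -> R[i]^o) (l : R[i]^o) :
  u @ \oo --> l -> limn u = l.
Proof. by move=> ul; apply: cvg_lim ul; exact: norm_hausdorff. Qed.

Lemma cvg_normc_ub (R : realType) (u : nat -> R[i]^o) (l : R[i]^o) (B : R) :
  u @ \oo --> l -> (forall n, normc (u n) <= B) -> normc l <= B.
Proof.
move=> /cvg_normc ul uB; rewrite -(cvg_lim _ ul)//.
by apply: limr_le; [exact: cvgP ul|exact: nearW].
Qed.

Lemma cvg_normc_lb (R : realType) (u : nat -> R[i]^o) (l : R[i]^o) (B : R) :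
  u @ \oo --> l -> (forall n, B <= normc (u n)) -> B <= normc l.
Proof.
move=> /cvg_normc ul uB; rewrite -(cvg_lim _ ul)//.
by apply: limr_ge; [exact: cvgP ul|exact: nearW].
Qed.

(** * Series dominated by a geometric series *)

Lemma geometric_series_le (R : realType) (K r : R) n :
  0 <= K -> 0 <= r < 1 -> \sum_(0 <= j < n) K * r ^+ j <= K / (1 - r).
Proof.
move=> K0 /andP[r0 r1].
have /(geometric_seriesE K)/(congr1 (@^~ n)) : r != 1 by rewrite lt_eqF.
rewrite /series/= => ->; rewrite ler_pM2r ?invr_gt0 ?subr_gt0//.
by rewrite ler_piMr// gerBl exprn_ge0.
Qed.

Lemma normc_series_le (R : realType) (u : nat -> R[i]^o) (K r : R) n :
  0 <= r < 1 -> (forall n, normc (u n) <= K * r ^+ n) ->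
  normc (series u n) <= K / (1 - r).
Proof.
move=> r01 uK.
have K0 : 0 <= K.
  by have := uK 0%N; rewrite expr0 mulr1; apply: le_trans; exact: normc_ge0.
apply: le_trans (geometric_series_le n K0 r01); rewrite /series/=.
elim/big_ind2 : _ => //[|x a y b xa yb]; first by rewrite normc0.
by rewrite (le_trans (le_normcD _ _))// lerD.
Qed.

Lemma normr_Re_le (R : realType) (z : R[i]^o) : `|complex.Re z| <= normc z.
Proof. by rewrite -lecR; exact: normc_ge_Re. Qed.

Lemma normr_Im_le (R : realType) (z : R[i]^o) : `|complex.Im z| <= normc z.
Proof.
case: z => a b /=; rewrite -sqrtr_sqr; apply: ler_wsqrtr.
by rewrite lerDr sqr_ge0.
Qed.

Lemma normc_le_ReIm (R : realType) (z : R[i]^o) :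
  normc z <= `|complex.Re z| + `|complex.Im z|.
Proof.
case: z => a b /=; rewrite -[leRHS]ger0_norm ?addr_ge0// -sqrtr_sqr.
apply: ler_wsqrtr; rewrite sqrrD !real_normK ?num_real// lerD2r lerDl.
by rewrite mulrn_wge0// mulr_ge0.
Qed.

Lemma cvgr_geometric_dominated (R : realType) (v : nat -> R) (K r : R) :
  0 <= r < 1 -> (forall n, `|v n| <= K * r ^+ n) -> cvgn (series v).
Proof.
move=> /andP[r0 r1] vK; apply: normed_cvg.
apply: (series_le_cvg (v_ := geometric K r)) => //.
- by move=> n; exact: normr_ge0.
- by move=> n; exact: le_trans (normr_ge0 _) (vK n).
- by apply: is_cvg_geometric_series; rewrite ger0_norm.
Qed.

(** The real and imaginary parts obey the same geometric bound, so the real criterion applies to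
    each, and the two real limits assemble into the complex one. *)
Lemma cvgc_geometric_dominated (R : realType) (u : nat -> R[i]^o) (K r : R) :
  0 <= r < 1 -> (forall n, normc (u n) <= K * r ^+ n) ->
  series u @ \oo --> limn (series u).
Proof.
move=> r01 uK.
have cRe : cvgn (series (fun n => complex.Re (u n))).
  apply: (cvgr_geometric_dominated r01) => n.
  exact: le_trans (normr_Re_le _) (uK n).
have cIm : cvgn (series (fun n => complex.Im (u n))).
  apply: (cvgr_geometric_dominated r01) => n.
  exact: le_trans (normr_Im_le _) (uK n).
set a := limn (series (fun n => complex.Re (u n))) in cRe.
set b := limn (series (fun n => complex.Im (u n))) in cIm.
suff ul : series u @ \oo --> (a +i* b : R[i]^o) by rewrite (limc_unique ul).
apply: (@cvg_normc_le _ _ _ (fun n =>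
    `|a - series (fun n => complex.Re (u n)) n|
    + `|b - series (fun n => complex.Im (u n)) n|)).
  move=> n; apply: le_trans (normc_le_ReIm _) _.
  have ReE : complex.Re (series u n) = series (fun n => complex.Re (u n)) n.
    elim: n => [|n IH]; first by rewrite /series/= !big_geq.
    by rewrite !seriesSr -IH; case: (series u n); case: (u n).
  have ImE : complex.Im (series u n) = series (fun n => complex.Im (u n)) n.
    elim: n {ReE} => [|n IH]; first by rewrite /series/= !big_geq.
    by rewrite !seriesSr -IH; case: (series u n); case: (u n).
  by rewrite -ReE -ImE; case: (series u n).
(* The limit 0 is written as [|a - a| + |b - b|], so that the limit rules apply termwise. *)
rewrite -[0]addr0 -[X in X + _](normr0 R) -[X in _ + X](normr0 R).
rewrite -{1}(subrr a) -(subrr b).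
by apply: cvgD; apply: cvg_norm; apply: cvgB => //; exact: cvg_cst.
Qed.

(** * Bounds and convergence for q-Pochhammer products *)

Lemma qpochSr (R : realType) (a p : R[i]^o) n :
  qpoch a p n.+1 = qpoch a p n * (1 - a * p ^+ n).
Proof. by rewrite /qpoch big_ord_recr. Qed.

Lemma qpochSl (R : realType) (a p : R[i]^o) n :
  qpoch a p n.+1 = (1 - a) * qpoch (a * p) p n.
Proof.
rewrite /qpoch big_ord_recl/= expr0 mulr1; congr (_ * _).
by apply: eq_bigr => j _; rewrite -mulrA -exprS.
Qed.

(** Each factor has modulus at most [1 + |a| |p|^j <= exp (|a| |p|^j)], and the exponents form a
    geometric sum. *)
Lemma normc_qpoch_ub (R : realType) (a p : R[i]^o) n :
  normc p < 1 -> normc (qpoch a p n) <= expR (normc a / (1 - normc p)).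
Proof.
move=> p1; have r01 : 0 <= normc p < 1 by rewrite normc_ge0.
apply: (@le_trans _ _ (expR (\sum_(0 <= j < n) normc a * normc p ^+ j))).
  elim: n => [|n IH]; first by rewrite /qpoch big_ord0 big_geq// expR0 normc1.
  rewrite qpochSr big_nat_recr//= expRD normcM ler_pM ?normc_ge0//.
  apply: le_trans (expR_ge1Dx _); apply: le_trans (normcB_le _ _) _.
  by rewrite normc1 normcM normcX.
by rewrite ler_expR geometric_series_le// normc_ge0.
Qed.

(* [1 / (1 - y) <= 1 + y / (1 - s) <= exp (y / (1 - s))]. *)
Lemma expRN_le_onem (R : realType) (s y : R) :
  0 <= y <= s -> s < 1 -> expR (- (y / (1 - s))) <= 1 - y.
Proof.
move=> /andP[y0 ys] s1; have s1' : 0 < 1 - s by rewrite subr_gt0.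
have t0 : 0 <= y / (1 - s) by rewrite divr_ge0// ltW.
have y1 : 0 < 1 - y by rewrite subr_gt0 (le_lt_trans ys).
rewrite expRN -[leRHS]invrK lef_pV2 ?posrE ?expR_gt0 ?invr_gt0//.
apply: le_trans (expR_ge1Dx _); rewrite -(ler_pM2l y1) divff ?gt_eqF//.
have -> : (1 - y) * (1 + y / (1 - s)) = 1 + y * (s - y) / (1 - s).
  by field; rewrite gt_eqF.
by rewrite lerDl divr_ge0 ?mulr_ge0 ?subr_ge0// ltW.
Qed.

(** Each factor has modulus at least [1 - s |p|^j >= exp (- s |p|^j / (1 - s))]. The resulting bound
    depends neither on [n] nor on the choice of [a] in the disc of radius [s]; this uniformity is
    what later controls all denominators at once. *)
Lemma normc_qpoch_lb (R : realType) (s : R) (a p : R[i]^o) n :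
  normc p < 1 -> normc a <= s -> s < 1 ->
  expR (- (s / (1 - s) / (1 - normc p))) <= normc (qpoch a p n).
Proof.
move=> p1 as1 s1; have r01 : 0 <= normc p < 1 by rewrite normc_ge0.
have s0 : 0 <= s by rewrite (le_trans _ as1)// normc_ge0.
have t0 : 0 <= s / (1 - s) by rewrite divr_ge0// subr_ge0 ltW.
apply: (@le_trans _ _ (expR (- \sum_(0 <= j < n) s / (1 - s) * normc p ^+ j))).
  by rewrite ler_expR lerN2 geometric_series_le.
elim: n => [|n IH]; first by rewrite /qpoch big_ord0 big_geq// oppr0 expR0 normc1.
rewrite qpochSr big_nat_recr//= opprD expRD normcM.
rewrite ler_pM ?expR_ge0//.
have yE : s / (1 - s) * normc p ^+ n = s * normc p ^+ n / (1 - s) by rewrite mulrAC.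
rewrite yE; apply: (@le_trans _ _ (1 - s * normc p ^+ n)).
  apply: expRN_le_onem => //; rewrite mulr_ge0 ?exprn_ge0 ?normc_ge0//=.
  by rewrite ler_piMr// exprn_ile1// ?normc_ge0// ltW.
apply: le_trans (normcB_ge _ _); rewrite normc1 normcM normcX lerB//.
by rewrite ler_wpM2r// exprn_ge0// normc_ge0.
Qed.

(** The product is the telescoping sum of its increments. These decay geometrically, which gives
    convergence of the infinite product as well as its distance to 1. *)
Lemma qpoch_series (R : realType) (a p : R[i]^o) n :
  qpoch a p n = 1 + series (fun j => - (a * p ^+ j * qpoch a p j)) n.
Proof.
rewrite /series/=; elim: n => [|n IH].
  by rewrite /qpoch big_ord0 big_geq// addr0.
by rewrite qpochSr big_nat_recr//= addrA -IH mulrBr mulr1 [qpoch _ _ _ * (_ * _)]mulrC.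
Qed.

Lemma normc_qpoch_increment (R : realType) (a p : R[i]^o) n :
  normc p < 1 ->
  normc (- (a * p ^+ n * qpoch a p n)) <=
    normc a * expR (normc a / (1 - normc p)) * normc p ^+ n.
Proof.
move=> p1; rewrite normcN !normcM normcX mulrAC ler_wpM2r ?exprn_ge0 ?normc_ge0//.
by rewrite ler_wpM2l ?normc_ge0// normc_qpoch_ub.
Qed.

Lemma cvg_qpoch (R : realType) (a p : R[i]^o) :
  normc p < 1 -> qpoch a p @ \oo --> qpoch_inf a p.
Proof.
move=> p1; have r01 : 0 <= normc p < 1 by rewrite normc_ge0.
set w := fun j : nat => - (a * p ^+ j * qpoch a p j).
suff ql : qpoch a p @ \oo --> 1 + limn (series w).
  by rewrite /qpoch_inf (limc_unique ql).
rewrite (_ : qpoch a p = (fun n => 1 + series w n)); last first.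
  by apply/funext => n; exact: qpoch_series.
apply: cvgD; first exact: cvg_cst.
apply: (cvgc_geometric_dominated r01) => n; exact: normc_qpoch_increment.
Qed.

Lemma normc_qpoch_inf_ub (R : realType) (a p : R[i]^o) :
  normc p < 1 -> normc a <= 1 ->
  normc (qpoch_inf a p) <= expR (1 - normc p)^-1.
Proof.
move=> p1 a1; apply: (cvg_normc_ub (cvg_qpoch p1)) => n.
apply: le_trans (normc_qpoch_ub _ _ p1) _.
by rewrite ler_expR ler_piMl// invr_ge0 subr_ge0 ltW.
Qed.

Lemma normc_qpoch_inf_lb (R : realType) (s : R) (a p : R[i]^o) :
  normc p < 1 -> normc a <= s -> s < 1 ->
  expR (- (s / (1 - s) / (1 - normc p))) <= normc (qpoch_inf a p).
Proof.
move=> p1 as1 s1; apply: (cvg_normc_lb (cvg_qpoch p1)) => n.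
exact: normc_qpoch_lb.
Qed.

Lemma qpoch_inf_neq0 (R : realType) (a p : R[i]^o) :
  normc p < 1 -> normc a < 1 -> qpoch_inf a p != 0.
Proof.
move=> p1 a1; apply/eqP => q0.
have := normc_qpoch_inf_lb p1 (lexx _) a1.
by rewrite q0 normc0 leNgt expR_gt0.
Qed.

(** The increments are all proportional to [a], hence the factor [|a|]. For [a = p^(n+k)] it yields
    the geometric rate in [k], uniformly in [n]. *)
Lemma normc_qpoch_infB1 (R : realType) (a p : R[i]^o) :
  normc p < 1 -> normc a <= 1 ->
  normc (qpoch_inf a p - 1) <= expR (1 - normc p)^-1 / (1 - normc p) * normc a.
Proof.
move=> p1 a1; have r01 : 0 <= normc p < 1 by rewrite normc_ge0.
have cq : qpoch a p n - 1 @[n --> \oo] --> qpoch_inf a p - 1.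
  exact: (cvgB (cvg_qpoch (a := a) p1) (cvg_cst (1 : R[i]^o))).
apply: (cvg_normc_ub cq) => n; rewrite qpoch_series addrAC subrr add0r.
rewrite mulrC mulrA; apply: normc_series_le => // j.
apply: le_trans (normc_qpoch_increment _ _ p1) _.
rewrite ler_wpM2r ?exprn_ge0 ?normc_ge0// ler_wpM2l ?normc_ge0//.
by rewrite ler_expR ler_piMl// invr_ge0 subr_ge0 ltW.
Qed.

Lemma qpoch_infS (R : realType) (a p : R[i]^o) :
  normc p < 1 -> qpoch_inf a p = (1 - a) * qpoch_inf (a * p) p.
Proof.
move=> p1; apply: limc_unique; rewrite -(cvg_shiftS (qpoch a p)).
under eq_fun do rewrite /= qpochSl.
by apply: cvgM; [exact: cvg_cst|exact: cvg_qpoch].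
Qed.

Lemma qpoch_inf1 (R : realType) (p : R[i]^o) :
  normc p < 1 -> qpoch_inf 1 p = 0.
Proof. by move=> p1; rewrite qpoch_infS// subrr mul0r. Qed.

Lemma cvg_qpoch_inf_expr (R : realType) (a p : R[i]^o) :
  normc p < 1 -> normc a <= 1 -> qpoch_inf (a * p ^+ n) p @[n --> \oo] --> (1 : R[i]^o).
Proof.
move=> p1 a1; set K := expR (1 - normc p)^-1 / (1 - normc p) * normc a.
apply: (@cvg_normc_le _ _ _ (geometric K (normc p))) => [n|]; last first.
  by apply: cvg_geometric; rewrite ger0_norm ?normc_ge0.
have ap1 : normc (a * p ^+ n) <= 1.
  by rewrite normcM normcX mulr_ile1 ?exprn_ile1 ?exprn_ge0 ?normc_ge0// ltW.
rewrite normcBC (le_trans (normc_qpoch_infB1 p1 ap1))//=.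
by rewrite normcM normcX mulrA.
Qed.

(** * The series [U(a)] and its functional equation *)

Definition heine_term (R : realType) (a p : R[i]^o) (n : nat) : R[i]^o :=
  qpoch_inf (p ^+ n.+1) p * p ^+ n / qpoch_inf (a * p ^+ n) p ^+ 2.

(** This is [U(a)]. Since [(a p^n; p)_oo = (a; p)_oo / (a; p)_n], it equals
    [(p; p)_oo / (a; p)_oo^2] times the basic hypergeometric series [2phi1(a, a; 0; p, p)]. *)
Definition heine_sum (R : realType) (a p : R[i]^o) : R[i]^o :=
  limn (series (heine_term a p)).

(** The upper bound for the numerator product over the square of the lower bound for the denominator
    product, with [r = |p|] and [|a| <= s]. *)
Definition heine_bound (R : realType) (s r : R) : R :=
  expR (1 - r)^-1 / expR (- (s / (1 - s) / (1 - r))) ^+ 2.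

Lemma normc_heine_term (R : realType) (s : R) (a p : R[i]^o) n :
  normc p < 1 -> normc a <= s -> s < 1 ->
  normc (heine_term a p n) <= heine_bound s (normc p) * normc p ^+ n.
Proof.
move=> p1 as1 s1; have r0 := normc_ge0 p.
rewrite /heine_term /heine_bound !normcM normcV !normcX mulrAC.
rewrite ler_wpM2r ?exprn_ge0// ler_pM ?normc_ge0 ?invr_ge0 ?exprn_ge0 ?normc_ge0//.
  by rewrite normc_qpoch_inf_ub// normcX exprn_ile1// ltW.
have aps : normc (a * p ^+ n) <= s.
  rewrite normcM normcX (le_trans _ as1)// ler_piMr ?normc_ge0// exprn_ile1//.
  exact: ltW.
have lb := normc_qpoch_inf_lb p1 aps s1.
rewrite lef_pV2 ?posrE ?exprn_gt0 ?expR_gt0 ?(lt_le_trans (expR_gt0 _) lb)//.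
by rewrite lerXn2r ?nnegrE ?expR_ge0 ?normc_ge0.
Qed.

Lemma cvg_heine_sum (R : realType) (a p : R[i]^o) :
  normc p < 1 -> normc a < 1 ->
  series (heine_term a p) @ \oo --> heine_sum a p.
Proof.
move=> p1 a1; have r01 : 0 <= normc p < 1 by rewrite normc_ge0.
by apply: (cvgc_geometric_dominated r01) => n; exact: normc_heine_term.
Qed.

Lemma normc_heine_sum (R : realType) (s : R) (a p : R[i]^o) :
  normc p < 1 -> normc a <= s -> s < 1 ->
  normc (heine_sum a p) <= heine_bound s (normc p) / (1 - normc p).
Proof.
move=> p1 as1 s1; have r01 : 0 <= normc p < 1 by rewrite normc_ge0.
apply: (cvg_normc_ub (cvg_heine_sum p1 (le_lt_trans as1 s1))) => n.
by apply: normc_series_le => // j; exact: normc_heine_term.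
Qed.

(** Here [x = p^n], [X = (p^(n+1); p)_oo] and [Y = (a p^(n+1); p)_oo]. The terms in [a^2 p] match on
    both sides; what remains is [(1 - a x)^2 - (1 - x) (1 - a^2 x) = (1 - a)^2 x]. *)
Lemma heine_telescope_field (F : fieldType) (a p x X Y : F) :
  1 - a * x != 0 -> Y != 0 ->
  X * (1 - a ^+ 2 * (p * x)) / Y ^+ 2
    - (1 - x) * X * (1 - a ^+ 2 * x) / ((1 - a * x) * Y) ^+ 2 =
  (1 - a) ^+ 2 * (X * x / ((1 - a * x) * Y) ^+ 2) - a ^+ 2 * p * (X * x / Y ^+ 2).
Proof. by move=> ax0 Y0; field; rewrite ax0 Y0. Qed.

Lemma heine_telescope (R : realType) (a p : R[i]^o) n :
  normc p < 1 -> normc a < 1 ->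
  let c n := qpoch_inf (p ^+ n) p * (1 - a ^+ 2 * p ^+ n)
             / qpoch_inf (a * p ^+ n) p ^+ 2 in
  c n.+1 - c n =
    (1 - a) ^+ 2 * heine_term a p n - a ^+ 2 * p * heine_term (a * p) p n.
Proof.
move=> p1 a1 c; have r0 := normc_ge0 p.
have lt1 m : normc (a * p ^+ m) < 1.
  rewrite normcM normcX (le_lt_trans _ a1)// ler_piMr ?normc_ge0//.
  by rewrite exprn_ile1// ltW.
have := qpoch_inf_neq0 p1 (lt1 n); rewrite qpoch_infS// mulf_eq0 negb_or.
move=> /andP[ax0 _].
have Y0 := qpoch_inf_neq0 p1 (lt1 n.+1).
have E1 : qpoch_inf (p ^+ n) p = (1 - p ^+ n) * qpoch_inf (p ^+ n.+1) p.
  by rewrite qpoch_infS// exprSr.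
have E2 : qpoch_inf (a * p ^+ n) p = (1 - a * p ^+ n) * qpoch_inf (a * p ^+ n.+1) p.
  by rewrite qpoch_infS// -mulrA exprSr.
have E3 : a * p * p ^+ n = a * p ^+ n.+1 by rewrite -mulrA exprS.
rewrite /c /heine_term E3 E1 E2.
move: (qpoch_inf (p ^+ n.+1) p) (qpoch_inf (a * p ^+ n.+1) p) Y0 => X Y Y0.
rewrite (exprS p n); exact: (@heine_telescope_field R[i]).
Qed.

Lemma heine_sum_rec (R : realType) (a p : R[i]^o) :
  normc p < 1 -> normc a < 1 ->
  (1 - a) ^+ 2 * heine_sum a p = 1 + a ^+ 2 * p * heine_sum (a * p) p.
Proof.
move=> p1 a1.
have ap1 : normc (a * p) < 1.
  by rewrite normcM mulr_ilt1 ?normc_ge0.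
pose c n : R[i]^o := qpoch_inf (p ^+ n) p * (1 - a ^+ 2 * p ^+ n)
             / qpoch_inf (a * p ^+ n) p ^+ 2.
have c1 : c @ \oo --> (1 : R[i]^o).
  rewrite -[1 in X in _ --> X]mulr1 -{2}(invr1 R[i]).
  apply: cvgM; [rewrite -[1 in X in _ --> X]mulr1; apply: cvgM|apply: cvgV].
  (* The numerator product [(p^n; p)_oo] is the case [a = 1]. *)
  - have := cvg_qpoch_inf_expr p1 (_ : normc (1 : R[i]) <= 1).
    by rewrite normc1 => /(_ (lexx _)); under eq_fun do rewrite mul1r.
  - have pn : (p ^+ n : R[i]^o) @[n --> \oo] --> (0 : R[i]^o).
      apply: (@cvg_normc_le _ _ _ (geometric 1 (normc p))) => [n|].
        by rewrite sub0r normcN normcX/= mul1r.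
      by apply: cvg_geometric; rewrite ger0_norm ?normc_ge0.
    rewrite -[1 in X in _ --> X](subr0 (1 : R[i]^o)) -[X in 1 - X](mulr0 (a ^+ 2)).
    by apply: cvgB; [exact: cvg_cst|apply: cvgM; [exact: cvg_cst|exact: pn]].
  - by rewrite oner_eq0.
  - rewrite -[1 in X in _ --> X](expr1n _ 2) expr2; under eq_fun do rewrite expr2.
    by apply: cvgM; apply: cvg_qpoch_inf_expr => //; exact: ltW.
have cE n : c n = (1 - a) ^+ 2 * series (heine_term a p) n
                  - a ^+ 2 * p * series (heine_term (a * p) p) n.
  rewrite /series/=; elim: n => [|n IH].
    (* [c 0 = 0] because [(1; p)_oo] has a vanishing first factor, so the telescoping sum leaves no
       boundary term at 0. *)
    by rewrite /c expr0 qpoch_inf1// !big_geq// !mulr0 !mul0r subr0.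
  rewrite !big_nat_recr//= !mulrDr opprD addrACA -IH -(heine_telescope n p1 a1).
  by rewrite addrC subrK.
have c2 : c @ \oo --> (1 - a) ^+ 2 * heine_sum a p - a ^+ 2 * p * heine_sum (a * p) p.
  rewrite (_ : c = fun n => (1 - a) ^+ 2 * series (heine_term a p) n
                  - a ^+ 2 * p * series (heine_term (a * p) p) n); last exact/funext.
  apply: cvgB; apply: cvgM; try exact: cvg_cst; exact: cvg_heine_sum.
by apply/eqP; rewrite -subr_eq -(limc_unique c2) (limc_unique c1).
Qed.

(** * From the functional equation to [omega] *)

Lemma heine_sum_omega_step (F : fieldType) (q x Q S U V : F) :
  1 - q * x != 0 -> (1 - q * x) ^+ 2 * U = 1 + (q * x) ^+ 2 * q ^+ 2 * V ->
  S / Q ^+ 2 * U =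
  S / (Q * (1 - q * x)) ^+ 2
  + S * (q * x) ^+ 2 * q ^+ 2 / (Q * (1 - q * x)) ^+ 2 * V.
Proof.
move=> qx0 UV; rewrite exprMn (invfM (Q ^+ 2)).
have -> : U = (1 + (q * x) ^+ 2 * q ^+ 2 * V) / (1 - q * x) ^+ 2.
  by rewrite -UV mulrAC divff ?mul1r// expf_eq0.
by move: (Q ^+ 2)^-1 ((1 - q * x) ^+ 2)^-1 => i j; ring.
Qed.

Lemma heine_sum_omega_iter (R : realType) (q : R[i]^o) n : normc q < 1 ->
  heine_sum q (q ^+ 2) = series (omega_term q) n
    + q ^+ (2 * n * (n + 1)) / qpoch q (q ^+ 2) n ^+ 2
      * heine_sum (q * (q ^+ 2) ^+ n) (q ^+ 2).
Proof.
move=> q1; have r0 := normc_ge0 q.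
have p1 : normc (q ^+ 2) < 1 by rewrite normcX exprn_ilt1.
elim: n => [|n ->].
  by rewrite /series/= big_geq// add0r !expr0 mulr1 /qpoch big_ord0 expr1n invr1 !mul1r.
have a1 : normc (q * (q ^+ 2) ^+ n) < 1.
  rewrite normcM (le_lt_trans _ q1)// ler_piMr// !normcX.
  by rewrite exprn_ile1 ?exprn_ge0// exprn_ile1// ltW.
have a0 : 1 - q * (q ^+ 2) ^+ n != 0.
  by apply/eqP => /subr0_eq a0; rewrite -a0 normc1 ltxx in a1.
have UV := heine_sum_rec p1 a1.
rewrite seriesSr -addrA; congr (_ + _).
(* The step is taken with [x = q^(2n)], [Q = (q; q^2)_n], [S = q^(2n(n+1))], [U = U(q x)] and
   [V = U(q^3 x)]: the 1 of the functional equation gives the next term of [omega], the rest is the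
   new remainder. *)
rewrite (heine_sum_omega_step (F := R[i]) _ _ a0 UV) /omega_term qpochSr.
congr (_ + _ / _ * heine_sum _ _).
(* Exponents: [2n(n+1) + 2(2n+1) + 2 = 2(n+1)(n+2)]. *)
- by rewrite -exprM -(exprS q) -exprM -!exprD; congr (_ ^+ _); lia.
- by rewrite -mulrA -exprSr.
Qed.

Lemma cvg_omega (R : realType) (q : R[i]^o) : normc q < 1 ->
  series (omega_term q) @ \oo --> heine_sum q (q ^+ 2).
Proof.
move=> q1; have r0 := normc_ge0 q; set s := normc q.
have p1 : normc (q ^+ 2) < 1 by rewrite normcX exprn_ilt1.
(* In the remainder, [c] bounds [|(q; q^2)_n|] from below and [B] bounds [|U(q^(2n+1))|] from above,
   both uniformly in [n] since [|q^(2n+1)| <= s]. *)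
set c := expR (- (s / (1 - s) / (1 - normc (q ^+ 2)))).
set B := heine_bound s (normc (q ^+ 2)) / (1 - normc (q ^+ 2)).
apply: (@cvg_normc_le _ _ _ (geometric (B / c ^+ 2) s)) => [n|]; last first.
  by apply: cvg_geometric; rewrite ger0_norm.
rewrite (heine_sum_omega_iter n q1) addrAC subrr add0r !normcM normcV !normcX/=.
rewrite [leRHS]mulrC mulrA -[leRHS]mulrA [B / _]mulrC mulrA.
rewrite !ler_pM ?mulr_ge0 ?invr_ge0 ?exprn_ge0 ?normc_ge0//.
(* The crude inequality [n <= 2n(n+1)] already makes the remainder decay geometrically. *)
- by rewrite ler_wiXn2l ?(ltW q1)// mulnAC leq_pmull// addn1 muln_gt0.
- rewrite lef_pV2 ?posrE ?exprn_gt0 ?expR_gt0//.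
    by rewrite lerXn2r ?nnegrE ?expR_ge0 ?normc_ge0// normc_qpoch_lb.
  exact: lt_le_trans (expR_gt0 _) (normc_qpoch_lb n p1 (lexx _) q1).
- apply: normc_heine_sum => //.
  rewrite normcM ler_piMr// !normcX exprn_ile1 ?exprn_ge0// exprn_ile1//.
  exact: ltW.
Qed.

(** * Comparison of [F1] with [q U(q)] as [k] grows *)

Lemma F1_termE (R : realType) (q : R[i]^o) k n :
  F1_term k q n =
  q * (heine_term q (q ^+ 2) n * qpoch_inf ((q ^+ 2) ^+ (n + k)) (q ^+ 2)).
Proof.
rewrite /F1_term /heine_term -!exprM -(exprS q) !mulnDr.
have -> : (2 * n.+1 = 2 * n + 2)%N by lia.
have -> : ((2 * n).+1 = 2 * n + 1)%N by lia.
rewrite (addn1 (2 * n)) (exprS q (2 * n)).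
rewrite mulrCA; congr (_ * _); rewrite mulrAC [RHS]mulrAC; congr (_ / _).
exact: mulrAC.
Qed.

Theorem theorem1p4 (R : realType) (q : R[i]^o) (hq : `|q| < 1) :
  F1 k q @[k --> \oo] --> q * omega q.
Proof.
have q1 : normc q < 1 by rewrite -ltcR -norm_normc.
have r0 := normc_ge0 q; have s1 := q1; set s := normc q in s1.
have p1 : normc (q ^+ 2) < 1 by rewrite normcX exprn_ilt1.
have r01 : 0 <= normc (q ^+ 2) < 1 by rewrite normc_ge0.
rewrite /omega (limc_unique (cvg_omega q1)).
set r := normc (q ^+ 2) in p1 r01.
set H := heine_bound s r.
set D := expR (1 - r)^-1 / (1 - r).
have D0 : 0 <= D by rewrite divr_ge0 ?expR_ge0// subr_ge0 ltW.
pose d k n : R[i]^o := q * heine_term q (q ^+ 2) n - F1_term k q n.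
(* [H r^n] bounds the summand of [U(q)], [D r^k] bounds the distance of [(p^(n+k); p)_oo] to 1, and
   the outer factor [q] has modulus below 1. The factor [r^n] makes the differences summable, while
   [r^k] makes their sum tend to 0. *)
have dE k n : normc (d k n) <= H * D * r ^+ k * r ^+ n.
  have pk1 : normc ((q ^+ 2) ^+ (n + k)) <= 1.
    by rewrite normcX exprn_ile1 ?normc_ge0// ltW.
  rewrite /d F1_termE -mulrBr -[X in _ * (X - _)]mulr1 -mulrBr 2!normcM normcBC.
  rewrite -[leRHS]mul1r ler_pM ?mulr_ge0 ?normc_ge0 ?(ltW s1)//.
  have -> : H * D * r ^+ k * r ^+ n = H * r ^+ n * (D * r ^+ k) by ring.
  rewrite ler_pM ?normc_ge0//.
    exact: normc_heine_term.
  apply: le_trans (normc_qpoch_infB1 p1 pk1) _; rewrite -/D ler_wpM2l//.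
  (* The bound [r^(n+k)] is weakened to [r^k]; the decay in [n] comes from the summand of [U(q)]. *)
  rewrite normcX -/r exprD ler_piMl ?exprn_ge0 ?exprn_ile1 ?normc_ge0//.
  exact: ltW.
have sE k n : series (F1_term k q) n
    = q * series (heine_term q (q ^+ 2)) n - series (d k) n.
  rewrite /series/= mulr_sumr -sumrB; apply: eq_bigr => j _.
  by rewrite /d subKr.
have dc k : series (d k) @ \oo --> limn (series (d k)).
  exact: cvgc_geometric_dominated r01 (dE k).
have F1E k : F1 k q = q * heine_sum q (q ^+ 2) - limn (series (d k)).
  apply: limc_unique; rewrite (funext (sE k)); apply: cvgB => //.
  by apply: cvgM; [exact: cvg_cst|exact: cvg_heine_sum].
apply: (@cvg_normc_le _ _ _ (geometric (H * D / (1 - r)) r)) => [k|]; last first.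
  by apply: cvg_geometric; rewrite ger0_norm ?normc_ge0.
rewrite F1E subKr /= mulrAC; apply: (cvg_normc_ub (dc k)) => n.
exact: normc_series_le.
Qed.
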